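(* Consider the generalized surface code of a tiling $(V,E,F)$ of a surface with boundary, with non-open vertex set $\mathring{V}$ and non-open edge set $\mathring{E}$. Let $I\subseteq\mathring{E}$ be a set of $\delta$ erased qubits such that the code can correct erasures at $I$. Then correction of the erasures at $I$ requires at most $\delta$ measurements of vertices and at most $\delta$ measurements of faces, independently of the code parameters: there exist $V'\subseteq\mathring{V}$ and $F'\subseteq F$ with $|V'|\le\delta$ and $|F'|\le\delta$ such that the $Z$ erasures at $I$ are identified by measuring $X_v$ for $v\in V'$ and the $X$ erasures at $I$ are identified by measuring $Z_f$ for $f\in F'$.
   Context: Generalized surface code. $(V,E,F)$ is a finite tiling of a topological surface, possibly with boundary: $V$ is the vertex set; an edge $e=\{u,v\}\in E$ connects two vertices $u,v$; a face $f\in F\subseteq 2^E$ is identified with the set of edges of the cycle surrounding it. Every edge lies in one or two faces. An edge $e$ is boundary if it lies in exactly one face; a vertex is boundary if it belongs to a boundary edge. Each boundary edge is arbitrarily declared open or closed; a boundary vertex is open if it belongs to an open boundary edge, and closed otherwise. $\mathring{V}$ (resp. $\mathring{E}$) is the set of non-boundary or closed boundary vertices (resp. edges). The code has one qubit for each $e\in\mathring{E}$, $n=|\mathring{E}|$, and its stabilizer group is generated by $X_v=\bigotimes_{e\in\mathring{E},\,v\in e}X_e$ for $v\in\mathring{V}$ and $Z_f=\bigotimes_{e\in f\cap\mathring{E}}Z_e$ for $f\in F$, where $X_e,Z_e$ are the Pauli matrices on qubit $e$; these generators commute. For $v\in\mathring{V}$ let $\vec{v}\in\mathbf{F}_2^n$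 have component $1$ at $e\in\mathring{E}$ if $v\in e$ and $0$ otherwise; for $f\in F$ let $\vec{f}\in\mathbf{F}_2^n$ have component $1$ at $e\in\mathring{E}$ if $e\in f$ and $0$ otherwise. Let $C_X$ be the linear code generated by $\{\vec{f}:f\in F\}$ and $C_Z$ that generated by $\{\vec{v}:v\in\mathring{V}\}$. $\mathbf{F}_2^{I}=\{(a_e)\in\mathbf{F}_2^n:a_e=0\text{ if }e\notin I\}$; $C^{\perp e}$ is the Euclidean dual. The code can correct erasures at $I$ if and only if $C_Z\cap\mathbf{F}_2^I=C_X^{\perp e}\cap\mathbf{F}_2^I$ and $C_X\cap\mathbf{F}_2^I=C_Z^{\perp e}\cap\mathbf{F}_2^I$. An $X$ erasure at $I$ is an error $\bigotimes_e X_e^{a_e}$ with $\vec{a}\in\mathbf{F}_2^I$; measuring $Z_f$ yields $\vec{f}\cdot\vec{a}\in\mathbf{F}_2$. The $X$ erasures at $I$ are identified by measuring $Z_f$ for $f\in F'$ if the values $(\vec{f}\cdot\vec{a})_{f\in F'}$ determine $\vec{a}\in\mathbf{F}_2^I$ uniquely modulo $C_Z$. Likewise a $Z$ erasure is $\bigotimes_e Z_e^{b_e}$ with $\vec{b}\in\mathbf{F}_2^I$, measuring $X_v$ yields $\vec{v}\cdot\vec{b}$, and the $Z$ erasures at $I$ are identified by measuring $X_v$ for $v\in V'$ if $(\vec{v}\cdot\vec{b})_{v\in V'}$ determines $\vec{b}\in\mathbf{F}_2^I$ uniquely modulo $C_X$. *)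

(* Defs.v *)
From HB Require Import structures.
From mathcomp Require Import all_boot all_order all_algebra.
Set Implicit Arguments.
Unset Strict Implicit.
Unset Printing Implicit Defensive.
Import GRing.Theory.
Local Open Scope ring_scope.

(* A face is given by the set of edges of a simple cycle; as edges are sets
   of two vertices, such a cycle has at least three vertices. *)
Definition is_cycle (V : finType) (f : {set {set V}}) : Prop :=
  exists c : seq V,
    [/\ uniq c, (3 <= size c)%N & f = [set [set x; next c x] | x in c]].

(* Two edges at v are neighbours when some face contains both of them, that is
   when they are adjacent in the link of v. *)
Definition link_rel (V : finType) (F : {set {set {set V}}}) (v : V) :
    rel {set V} :=
  [rel a b : {set V} |
    [&& v \in a, v \in b & [exists f in F, (a \in f) && (b \in f)]]].

(* Each edge lies in one or two faces and each face has two edges at each of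
   its vertices, so the link of a vertex has all its degrees equal to 1 or 2.
   Its connectedness then says that it is a path or a circle, i.e. that
   gluing discs along the faces yields a surface, with or without boundary. *)
Record tiling (V : finType) := Tiling {
  edges : {set {set V}};
  faces : {set {set {set V}}};
  edge_card : forall e, e \in edges -> #|e| = 2%N;
  face_sub : forall f, f \in faces -> f \subset edges;
  face_cycle : forall f, f \in faces -> is_cycle f;
  edge_faces : forall e, e \in edges ->
    (1 <= #|[set f in faces | e \in f]| <= 2)%N;
  vertex_edge : forall v : V, exists2 e, e \in edges & v \in e;
  vertex_link : forall (v : V) (e1 e2 : {set V}),
    e1 \in edges -> e2 \in edges -> v \in e1 -> v \in e2 ->
    connect (link_rel faces v) e1 e2
}.

Definition boundary_edges (V : finType) (T : tiling V) : {set {set V}} :=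
  [set e in edges T | #|[set f in faces T | e \in f]| == 1%N].

Definition boundary_vertices (V : finType) (T : tiling V) : {set V} :=
  [set v | [exists e in boundary_edges T, v \in e]].

(* Below, O is the set of the boundary edges that are declared open. *)

Definition open_vertices (V : finType) (T : tiling V) (O : {set {set V}}) :
    {set V} :=
  [set v in boundary_vertices T | [exists e in O, v \in e]].

Definition nonopen_vertices (V : finType) (T : tiling V) (O : {set {set V}}) :
    {set V} :=
  ~: open_vertices T O.

Definition nonopen_edges (V : finType) (T : tiling V) (O : {set {set V}}) :
    {set {set V}} :=
  edges T :\: O.

(* The qubits are the non-open edges; coordinate i : 'I_n stands for the edge
   enum_val i. *)
Definition nqubits (V : finType) (T : tiling V) (O : {set {set V}}) : nat :=
  #|nonopen_edges T O|.

Definition qubit (V : finType) (T : tiling V) (O : {set {set V}})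
    (i : 'I_(nqubits T O)) : {set V} :=
  enum_val i.

Definition vertex_vec (V : finType) (T : tiling V) (O : {set {set V}})
    (v : V) : 'rV['F_2]_(nqubits T O) :=
  \row_i (v \in qubit i)%:R.

Definition face_vec (V : finType) (T : tiling V) (O : {set {set V}})
    (f : {set {set V}}) : 'rV['F_2]_(nqubits T O) :=
  \row_i (qubit i \in f)%:R.

(* The index X or Z is that of the errors to be detected: the face vectors,
   coming from the Z-type stabilizers, span codeX. *)
Definition codeX (V : finType) (T : tiling V) (O : {set {set V}}) :
    {vspace 'rV['F_2]_(nqubits T O)} :=
  <<[seq face_vec T O f | f in faces T]>>%VS.

Definition codeZ (V : finType) (T : tiling V) (O : {set {set V}}) :
    {vspace 'rV['F_2]_(nqubits T O)} :=
  <<[seq vertex_vec T O v | v in nonopen_vertices T O]>>%VS.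

Definition dot (n : nat) (a b : 'rV['F_2]_n) : 'F_2 :=
  \sum_(i < n) a 0 i * b 0 i.

Definition edual (n : nat) (C : {vspace 'rV['F_2]_n}) : {set 'rV['F_2]_n} :=
  [set a : 'rV['F_2]_n | [forall c in C, dot c a == 0]].

Definition supported (V : finType) (T : tiling V) (O I : {set {set V}}) :
    {set 'rV['F_2]_(nqubits T O)} :=
  [set a : 'rV['F_2]_(nqubits T O) |
    [forall i, (qubit i \notin I) ==> (a 0 i == 0)]].

(* Every Pauli error supported on I that commutes with all the stabilizers is,
   up to a phase, a stabilizer: its X part is in the span of the vertex vectors
   and its Z part in the span of the face vectors. *)
Definition correctable (V : finType) (T : tiling V) (O I : {set {set V}}) :
    Prop :=
  [set a in codeZ T O] :&: supported T O I
    = edual (codeX T O) :&: supported T O I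
  /\ [set a in codeX T O] :&: supported T O I
    = edual (codeZ T O) :&: supported T O I.

(* The syndromes at F' determine an error supported on I modulo codeZ, the
   X-type stabilizers. *)
Definition X_identified (V : finType) (T : tiling V) (O I : {set {set V}})
    (F' : {set {set {set V}}}) : Prop :=
  forall a a' : 'rV['F_2]_(nqubits T O),
    a \in supported T O I -> a' \in supported T O I ->
    (forall f, f \in F' -> dot (face_vec T O f) a = dot (face_vec T O f) a') ->
    a - a' \in codeZ T O.

Definition Z_identified (V : finType) (T : tiling V) (O I : {set {set V}})
    (V' : {set V}) : Prop :=
  forall b b' : 'rV['F_2]_(nqubits T O),
    b \in supported T O I -> b' \in supported T O I ->
    (forall v, v \in V' ->
       dot (vertex_vec T O v) b = dot (vertex_vec T O v) b') ->
    b - b' \in codeX T O.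

(* Main.v *)
(** Restricting every generator to the coordinates in [I] changes none of the
    syndromes of the errors supported on [I], and the restricted generators
    lie in a space of dimension at most [#|I|].  Measuring generators whose
    restrictions form a basis of the span thus decides whether an error
    commutes with all of them; by correctability, such an error is a
    stabilizer. *)
Require Import Defs.
From mathcomp Require Import all_boot all_order all_algebra.

Set Implicit Arguments.
Unset Strict Implicit.
Unset Printing Implicit Defensive.
Import GRing.Theory.
Local Open Scope ring_scope.

(** Scan the list from its end, keeping an index only when its vector lies outside the span of those
    already kept. Indices are returned rather than vectors, because what is to be selected are
    vertices and faces to measure. *)
Lemma free_subseq_span (K : fieldType) (vT : vectType K) (A : eqType)
    (w : A -> vT) (s : seq A) :
  exists s' : seq A, [/\ {subset s' <= s}, free (map w s') &
    <<map w s'>>%VS = <<map w s>>%VS].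
Proof.
elim: s => [|x s [s' [sub_s's free_s' span_s']]].
  by exists [::]; rewrite nil_free.
have [wx_in|wx_notin] := boolP (w x \in <<map w s'>>%VS).
  exists s'; split=> // [y /sub_s's|]; first by rewrite inE orbC => ->.
  by rewrite /= span_cons -span_s'; symmetry; apply/addv_idPr; rewrite -memvE.
exists (x :: s'); split=> [y| |] /=; last by rewrite !span_cons span_s'.
  by rewrite !inE => /orP[->//|/sub_s's ->]; rewrite orbT.
by rewrite free_cons wx_notin.
Qed.

Lemma exists_basis_subset (K : fieldType) (vT : vectType K) (A : finType)
    (w : A -> vT) (J : {set A}) :
  exists J' : {set A}, [/\ J' \subset J,
    (#|J'| <= \dim <<[seq w j | j in J]>>)%N &
    <<[seq w j | j in J']>>%VS = <<[seq w j | j in J]>>%VS].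
Proof.
have [s [sub_sJ free_s span_s]] := free_subseq_span w (enum J).
have span_J' : <<[seq w j | j in [set x in s]]>>%VS = <<map w s>>%VS.
  apply: eq_span => v; apply/imageP/mapP => -[j js ->]; exists j => //.
    by rewrite inE in js.
  by rewrite inE.
exists [set x in s]; split.
- by apply/subsetP => j; rewrite inE => /sub_sJ; rewrite mem_enum.
(* Freeness makes the dimension equal to the length of [s], which bounds the number of its distinct
   entries. *)
- by rewrite -span_s (eqP free_s) size_map cardsE card_size.
- by rewrite span_J'.
Qed.

Lemma dotE (n : nat) (a b : 'rV['F_2]_n) : dot a b = (a *m b^T) 0 0.
Proof. by rewrite mxE; apply: eq_bigr => i _; rewrite mxE. Qed.

Lemma dotBr (n : nat) (c a b : 'rV['F_2]_n) : dot c (a - b) = dot c a - dot c b.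
Proof. by rewrite !dotE linearB mulmxBr !mxE. Qed.

(** The vectors orthogonal to [d] form the kernel of a linear map, so this kernel contains a span as
    soon as it contains the generators. *)
Lemma dot_span_eq0 (n : nat) (X : seq 'rV['F_2]_n) (d : 'rV['F_2]_n) :
  (forall x, x \in X -> dot x d = 0) -> forall c, c \in <<X>>%VS -> dot c d = 0.
Proof.
move=> X0 c.
pose g : 'Hom('rV['F_2]_n, 'rV['F_2]_1) := linfun (mulmxr d^T).
suff /subvP sXg : (<<X>> <= lker g)%VS.
  by move=> /sXg; rewrite memv_ker lfunE /= dotE => /eqP->; rewrite mxE.
apply/span_subvP => x /X0 x0; rewrite memv_ker lfunE /=; apply/eqP/rowP => i.
by rewrite ord1 -dotE x0 mxE.
Qed.

Section Erasures.

Variables (V : finType) (T : tiling V) (O I : {set {set V}}).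
Implicit Types c d : 'rV['F_2]_(nqubits T O).

(** Coordinates outside [I] are set to zero rather than dropped, so that restricted vectors can
    still be paired with errors of full length. *)
Definition restrict_to c : 'rV['F_2]_(nqubits T O) :=
  \row_i (if qubit i \in I then c 0 i else 0).

Lemma dot_restrict_to c d : d \in supported T O I ->
  dot (restrict_to c) d = dot c d.
Proof.
rewrite inE => /forallP supp_d; apply: eq_bigr => i _; rewrite mxE.
by case: ifPn (supp_d i) => //= _ /eqP->; rewrite !mulr0.
Qed.

Lemma dim_restrict_to (X : seq 'rV['F_2]_(nqubits T O)) :
  (\dim <<map restrict_to X>> <= #|I|)%N.
Proof.
pose P := [set i : 'I_(nqubits T O) | qubit i \in I].
pose e_ i : 'rV['F_2]_(nqubits T O) := delta_mx 0 i.
pose D := [seq e_ i | i in P].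
have sub_D : (<<map restrict_to X>> <= <<D>>)%VS.
  apply/span_subvP => _ /mapP[c _ ->]; rewrite [restrict_to c]row_sum_delta.
  apply: memv_suml => i _; rewrite mxE.
  case: ifPn => [iI|_]; last by rewrite scale0r mem0v.
  by apply/memvZ/memv_span/(image_f e_); rewrite inE.
apply: (leq_trans (dimvS sub_D)); apply: (leq_trans (dim_span _)).
(* The enumeration of qubits is injective, so [P] has as many elements as its image, a set of edges
   inside [I]. *)
rewrite size_image -(card_imset P (@enum_val_inj _ _)).
by apply/subset_leq_card/subsetP => _ /imsetP[i + ->]; rewrite inE.
Qed.

Lemma supportedB d d' : d \in supported T O I -> d' \in supported T O I ->
  d - d' \in supported T O I.
Proof.
rewrite !inE => /forallP d0 /forallP d'0; apply/forallP => i; apply/implyP=> iI.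
by rewrite !mxE (eqP (implyP (d0 i) iI)) (eqP (implyP (d'0 i) iI)) subr0.
Qed.

Lemma exists_deciding_subset (A : finType)
    (w : A -> 'rV['F_2]_(nqubits T O)) (J : {set A}) :
  exists J' : {set A}, [/\ J' \subset J, (#|J'| <= #|I|)%N &
    forall a a', a \in supported T O I -> a' \in supported T O I ->
      (forall j, j \in J' -> dot (w j) a = dot (w j) a') ->
      a - a' \in edual <<[seq w j | j in J]>>%VS :&: supported T O I].
Proof.
have [J' [sJ'J leJ' spanJ']] := exists_basis_subset (restrict_to \o w) J.
exists J'; split=> // [|a a' supp_a supp_a' eq_aa'].
  by apply: leq_trans leJ' _; rewrite [image_mem _ _](map_comp restrict_to w) dim_restrict_to.
have supp_d := supportedB supp_a supp_a'.
rewrite inE supp_d andbT inE; apply/forall_inP => c cJ; apply/eqP.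
(* Linearity is used twice: here to replace [c] by a single generator, and then, once that generator
   is restricted to [I], to replace it by the chosen restrictions that span it. *)
apply: dot_span_eq0 cJ => _ /imageP[j jJ ->]; rewrite -dot_restrict_to //.
apply: (@dot_span_eq0 _ [seq (restrict_to \o w) j | j in J']).
  move=> _ /imageP[k kJ' ->] /=.
  by rewrite dot_restrict_to // dotBr eq_aa' // subrr.
by rewrite spanJ'; apply/memv_span/(image_f (restrict_to \o w)).
Qed.

End Erasures.

Local Close Scope ring_scope.

Theorem mainTheorem8 (V : finType) (T : tiling V) (O : {set {set V}})
    (hO : O \subset boundary_edges T)
    (I : {set {set V}}) (hI : I \subset nonopen_edges T O)
    (delta : nat) (hdelta : #|I| = delta)
    (hcorr : correctable T O I) :
  exists (V' : {set V}) (F' : {set {set {set V}}}),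
    V' \subset nonopen_vertices T O /\ F' \subset faces T /\
    #|V'| <= delta /\ #|F'| <= delta /\
    Z_identified T O I V' /\ X_identified T O I F'.
Proof.
have [corrZ corrX] := hcorr.
have [V' [sV' leV' decV']] :=
  exists_deciding_subset I (vertex_vec T O) (nonopen_vertices T O).
have [F' [sF' leF' decF']] := exists_deciding_subset I (face_vec T O) (faces T).
exists V', F'; rewrite -hdelta; do 4!split=> //; split.
(* The vertex vectors span [codeZ], and on [I] the dual of [codeZ] coincides with [codeX]; for the
   faces the two codes exchange roles. *)
- move=> b b' supp_b supp_b' /(decV' _ _ supp_b supp_b').
  by rewrite -/(codeZ T O) -corrX !inE => /andP[].
- move=> a a' supp_a supp_a' /(decF' _ _ supp_a supp_a').
  by rewrite -/(codeX T O) -corrZ !inE => /andP[].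
Qed.
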